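(* For every graph $G$, we have $t_b(G)=t(G)$.
   Context: Graphs are finite and simple with nonempty vertex set. A unit-distance representation of $G=(V,E)$ is a function $u: V\to\mathbb{R}^d$ for some $d\ge 1$ with $\|u(i)-u(j)\|=1$ (Euclidean norm) whenever $\{i,j\}\in E$. The hypersphere number $t(G)$ is the square of the smallest radius of a hypersphere (centered at the origin; radius $0$ allowed) that contains a unit-distance representation of $G$; equivalently, the minimum $t\in\mathbb{R}$ such that there is a positive semidefinite symmetric $V\times V$ matrix $X$ with $X_{ii}=t$ for all $i\in V$ and $X_{ii}-2X_{ij}+X_{jj}=1$ for all $\{i,j\}\in E$. The number $t_b(G)$ is the square of the smallest radius of a Euclidean ball that contains a unit-distance representation of $G$; equivalently, it is given by the same semidefinite program with $X_{ii}=t$ replaced by $X_{ii}\le t$ for all $i\in V$. *)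

(* Defs.v *)
From mathcomp Require Import all_boot all_order all_algebra.
From mathcomp Require Import all_classical all_reals all_analysis.
From mathcomp Require Import ring lra.

Set Implicit Arguments.
Unset Strict Implicit.
Unset Printing Implicit Defensive.

Import Order.TTheory GRing.Theory Num.Theory.
Import numFieldNormedType.Exports.

Local Open Scope classical_set_scope.
Local Open Scope ring_scope.

(* [`|x|] on ['rV[R]_d] is the sup norm, so the Euclidean norm is defined here. *)
Definition enorm (R : realType) (d : nat) (x : 'rV[R]_d) : R :=
  Num.sqrt (\sum_(k < d) x ord0 k ^+ 2).

Definition unit_distance_rep (R : realType) (V : finType) (e : rel V)
    (d : nat) (u : V -> 'rV[R]_d) : Prop :=
  forall i j : V, e i j -> enorm (u i - u j) = 1.

Definition sphere_radii (R : realType) (V : finType) (e : rel V) : set R :=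
  [set r : R | 0 <= r /\ exists (d : nat) (u : V -> 'rV[R]_d),
    [/\ (0 < d)%N, unit_distance_rep e u & forall i : V, enorm (u i) = r]].
Arguments sphere_radii R {V} e.

(* The center of the ball is arbitrary. *)
Definition ball_radii (R : realType) (V : finType) (e : rel V) : set R :=
  [set r : R | 0 <= r /\ exists (d : nat) (u : V -> 'rV[R]_d) (c : 'rV[R]_d),
    [/\ (0 < d)%N, unit_distance_rep e u & forall i : V, enorm (u i - c) <= r]].
Arguments ball_radii R {V} e.

(* The infima are minima: see [sphere_radius_attained] and
   [ball_radius_attained]. *)
Definition hypersphere_number (R : realType) (V : finType) (e : rel V) : R :=
  inf (sphere_radii R e) ^+ 2.
Arguments hypersphere_number R {V} e.

Definition ball_number (R : realType) (V : finType) (e : rel V) : R :=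
  inf (ball_radii R e) ^+ 2.
Arguments ball_number R {V} e.

Section Attained.
Context (R : realType).

Lemma gram_square (n d : nat) (M : 'M[R]_(n, d)) :
  exists L : 'M[R]_n, L *m L^T = M *m M^T.
Proof.
have trZ (a : R) m p (A : 'M[R]_(m, p)) : (a *: A)^T = a *: A^T.
  by apply/matrixP => i j; rewrite !mxE.
elim: n M => [|n IHn] M.
  by exists 0; apply/matrixP => -[].
pose r : 'rV[R]_d := @usubmx R 1 n d M.
pose M' : 'M[R]_(n, d) := @dsubmx R 1 n d M.
have Mdef : M = col_mx r M' by rewrite /r /M' (@vsubmxK R 1 n d M).
pose s := (r *m r^T) 0 0.
have sE : s = \sum_k r 0 k ^+ 2.
  by rewrite /s mxE; apply: eq_bigr => k _; rewrite !mxE expr2.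
have rrT : r *m r^T = s%:M by apply/matrixP => i j; rewrite !ord1 [RHS]mxE eqxx.
have s_ge0 : 0 <= s by rewrite sE; apply: sumr_ge0 => k _; exact: sqr_ge0.
have [q [qr qq]] : exists q : 'rV[R]_d,
    r = Num.sqrt s *: q /\ (q *m q^T) *m q = q.
  have [s0|s_neq0] := eqVneq s 0.
    exists 0; rewrite scaler0 mulmx0; split=> //.
    apply/rowP => k; rewrite [RHS]mxE; apply/eqP; rewrite -sqrf_eq0; apply/eqP.
    move/eqP: s0; rewrite sE psumr_eq0; last by move=> *; exact: sqr_ge0.
    by move/allP/(_ k (mem_index_enum _))/eqP.
  have ss : Num.sqrt s != 0 by rewrite sqrtr_eq0 -ltNge lt_def s_neq0.
  exists ((Num.sqrt s)^-1 *: r); rewrite scalerA mulfV// scale1r; split=> //.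
  rewrite trZ -!scalemxAr -!scalemxAl rrT mul_scalar_mx !scalerA.
  congr (_ *: _); rewrite -[X in _ * X](sqr_sqrtr s_ge0).
  by field.
pose N := M' - M' *m q^T *m q.
have [L' L'E] := IHn N.
pose L : 'M[R]_(1 + n) :=
  block_mx (Num.sqrt s *: (q *m q^T)) 0 (M' *m q^T) L'.
suff LL : L *m L^T = col_mx r M' *m (col_mx r M')^T.
  by exists L; rewrite Mdef; exact: LL.
have qq' : q^T *m (q *m q^T) = q^T.
  by have := congr1 trmx qq; rewrite !trmx_mul trmxK.
rewrite /L tr_block_mx mulmx_block tr_col_mx.
rewrite mul_col_row qr !trZ !trmx0 !trmx_mul !trmxK.
have Nq : N *m q^T = 0.
  by rewrite mulmxBl -!mulmxA qq' subrr.
have NN : M' *m q^T *m (q *m M'^T) + N *m N^T = M' *m M'^T.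
  have -> : N *m N^T = N *m M'^T.
    by rewrite linearB /= !trmx_mul trmxK mulmxBr (mulmxA N) Nq mul0mx subr0.
  by rewrite mulmxBl -!mulmxA addrC subrK.
rewrite L'E mul0mx !addr0 -?scalemxAl -?scalemxAr ?mulmx0 ?mul0mx ?addr0 NN.
congr block_mx; first by rewrite mulmxA qq.
  by rewrite !mulmxA qq.
by rewrite -!mulmxA qq'.
Qed.

Lemma sqr_enorm d (x : 'rV[R]_d) : enorm x ^+ 2 = \sum_(k < d) x ord0 k ^+ 2.
Proof. by rewrite sqr_sqrtr// sumr_ge0// => k _; exact: sqr_ge0. Qed.

Lemma enorm_ge0 d (x : 'rV[R]_d) : 0 <= enorm x.
Proof. exact: sqrtr_ge0. Qed.

Lemma sqr_enorm_mul d (x : 'rV[R]_d) : enorm x ^+ 2 = (x *m x^T) 0 0.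
Proof. by rewrite sqr_enorm mxE; apply: eq_bigr => k _; rewrite !mxE expr2. Qed.

Context (V : finType) (e : rel V).
Local Notation n := #|V|.

Lemma unit_distance_rep_square d (u : V -> 'rV[R]_d) :
  unit_distance_rep e u ->
  exists2 w : V -> 'rV[R]_n, unit_distance_rep e w &
    forall i, enorm (w i) = enorm (u i).
Proof.
move=> hu.
pose M : 'M[R]_(n, d) := \matrix_(a, k) u (enum_val a) 0 k.
have [L LE] := gram_square M.
have Mrow i : row (enum_rank i) M = u i.
  by apply/rowP => k; rewrite !mxE enum_rankK.
exists (fun i => row (enum_rank i) L) => [i j /hu <-|i]; apply/eqP;
  rewrite -(eqrXn2 (n := 2)) ?enorm_ge0//; apply/eqP; rewrite !sqr_enorm_mul.
- rewrite -!Mrow !rowE -!mulmxBl !trmx_mul !mulmxA.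
  by rewrite -(mulmxA _ L) -(mulmxA _ M) LE.
- by rewrite -!Mrow !rowE !trmx_mul !mulmxA -(mulmxA _ L) -(mulmxA _ M) LE.
Qed.

Let cts_mul (T : topologicalType) (f g : T -> R) :
  continuous f -> continuous g -> continuous (fun w => f w * g w).
Proof. by move=> fc gc w; apply: cvgM; [exact: fc|exact: gc]. Qed.

Let cts_sub (T : topologicalType) (f g : T -> R) :
  continuous f -> continuous g -> continuous (fun w => f w - g w).
Proof. by move=> fc gc w; apply: cvgB; [exact: fc|exact: gc]. Qed.

Let cts_sum (T : topologicalType) (F : 'I_n -> T -> R) :
  (forall k, continuous (F k)) -> continuous (fun w => \sum_k F k w).
Proof.
by move=> Fc; apply: continuous_big => //; exact: add_continuous.
Qed.

Local Notation I := (option (V * 'I_n)).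
Local Notation W := (prod_topology (fun _ : I => R : topologicalType)).

Let vec (w : W) (i : V) : 'rV[R]_n := \row_k w (Some (i, k)).

Let coord_cts (x : I) : continuous (fun w : W => w x : R).
Proof. exact: (@proj_continuous I (fun _ => R : topologicalType) x). Qed.

Let normc i : continuous (fun w : W => enorm (vec w i) ^+ 2).
Proof.
have -> : (fun w : W => enorm (vec w i) ^+ 2) =
  (fun w => \sum_k (w (Some (i, k)) * w (Some (i, k)))).
  apply/funext => w; rewrite sqr_enorm; apply: eq_bigr => k _.
  by rewrite mxE expr2.
by apply: cts_sum => k; apply: cts_mul; exact: coord_cts.
Qed.

Let distc i j : continuous (fun w : W => enorm (vec w i - vec w j) ^+ 2).
Proof.
have -> : (fun w : W => enorm (vec w i - vec w j) ^+ 2) =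
  (fun w => \sum_k ((w (Some (i, k)) - w (Some (j, k))) *
                    (w (Some (i, k)) - w (Some (j, k))))).
  apply/funext => w; rewrite sqr_enorm; apply: eq_bigr => k _.
  by rewrite !mxE expr2.
by apply: cts_sum => k; apply: cts_mul; apply: cts_sub; exact: coord_cts.
Qed.

Let radii (D : set R) : set R := [set r | 0 <= r /\
  exists d (u : V -> 'rV[R]_d), [/\ (0 < d)%N, unit_distance_rep e u &
    forall i, D (enorm (u i) ^+ 2 - r ^+ 2)]].

Let K (D : set R) : set W :=
  [set w | forall x, `[-1, 1]%classic (w x)] `&`
  ([set w | 0 <= w None] `&`
  ([set w | forall i j, e i j -> enorm (vec w i - vec w j) ^+ 2 = 1] `&`
   [set w | forall i, D (enorm (vec w i) ^+ 2 - w None ^+ 2)])).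

Let compactK D : closed D -> compact (K D).
Proof.
move=> cD; apply: compact_closedI.
  apply: (@tychonoff I (fun _ => R : topologicalType)
    (fun _ => `[-1, 1]%classic)) => _; exact: segment_compact.
apply: closedI.
  apply: (@closed_comp _ _ (fun w : W => w None) [set x | 0 <= x]).
    by move=> w _; exact: coord_cts.
  exact: closed_ge.
apply: closedI.
  have -> : [set w : W | forall i j, e i j ->
      enorm (vec w i - vec w j) ^+ 2 = 1] =
    \bigcap_(p in [set p : V * V | e p.1 p.2])
      [set w | enorm (vec w p.1 - vec w p.2) ^+ 2 = 1].
    by apply/seteqP; split=> [w h [i j] /h //|w h i j eij]; exact: (h (i, j)).
  apply: closed_bigI => -[i j] _.
  apply: (@closed_comp _ _ (fun w : W => enorm (vec w i - vec w j) ^+ 2)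
    [set x | x = 1]); first by move=> w _; exact: distc.
  exact: closed_eq.
have -> : [set w : W | forall i, D (enorm (vec w i) ^+ 2 - w None ^+ 2)] =
    \bigcap_(i in setT) [set w | D (enorm (vec w i) ^+ 2 - w None ^+ 2)].
  by apply/seteqP; split=> [w h i _|w h i]; exact: h.
apply: closed_bigI => i _.
apply: (@closed_comp _ _ (fun w : W => enorm (vec w i) ^+ 2 - w None ^+ 2) D)
  => // w _.
have h : continuous (fun w : W => enorm (vec w i) ^+ 2 - w None ^+ 2).
  apply: cts_sub; first exact: normc.
  by apply: cts_mul; exact: coord_cts.
exact: h.
Qed.

Hypotheses (e_irr : irreflexive e) (V_gt0 : (0 < #|V|)%N).

Let sphere_half : exists2 u : V -> 'rV[R]_n,
  unit_distance_rep e u & forall i, enorm (u i) ^+ 2 = 2^-1.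
Proof.
pose c : R := Num.sqrt 2^-1.
have cc : c * c = 2^-1 by rewrite -expr2 sqr_sqrtr// invr_ge0.
exists (fun i => c *: delta_mx 0 (enum_rank i)).
  move=> i j eij; rewrite /enorm.
  have ji : enum_rank j != enum_rank i.
    by apply: contraTneq eij => /enum_rank_inj ->; rewrite e_irr.
  rewrite (bigD1 (enum_rank i))//= (bigD1 (enum_rank j))//= big1.
    rewrite !mxE !eqxx /= (negPf ji) eq_sym (negPf ji) /= !mulr0 !mulr1.
    rewrite subr0 sub0r sqrrN expr2 cc addr0.
    by rewrite (_ : 2^-1 + 2^-1 = 1) ?sqrtr1//; field.
  move=> k /andP[ki kj]; rewrite !mxE (negPf ki) (negPf kj) /=.
  by rewrite !mulr0 subrr expr0n.
move=> i; rewrite sqr_enorm (bigD1 (enum_rank i))//= big1.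
  by rewrite !mxE !eqxx mulr1 expr2 cc addr0.
by move=> k ki; rewrite !mxE (negPf ki) /= mulr0 expr0n.
Qed.

Let radii_attained (D : set R) : closed D -> D 0 -> D `<=` [set x | x <= 0] ->
  radii D (inf (radii D)).
Proof.
move=> cD D0 Dle.
pose S := (fun w : W => w None : R) @` K D.
have cS : closed S.
  apply: compact_closed; first exact: norm_hausdorff.
  apply: continuous_compact; last exact: compactK.
  by apply: continuous_subspaceT; exact: coord_cts.
have SA : S `<=` radii D.
  move=> _ [w [_ [w0 [we wD]]] <-]; split=> //; exists n, (vec w); split=> //.
  move=> i j /we h; apply/eqP.
  by rewrite -(eqrXn2 (n := 2)) ?enorm_ge0// h expr1n.
have AS r : radii D r -> r <= 1 -> S r.
  move=> [r0 [d [u [_ ue uD]]]] r1.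
  have [w we wn] := unit_distance_rep_square ue.
  pose f : W := fun x => if x is Some (i, k) then w i 0 k else r.
  have vf i : vec f i = w i by apply/rowP => k; rewrite mxE.
  exists f => //; split=> /=; last first.
    split=> //; split=> [i j /we|i]; rewrite !vf ?wn//.
    by move=> ->; rewrite expr1n.
  move=> [[i k]|] /=; rewrite in_itv /=; last by rewrite r1 andbT; lra.
  rewrite -ler_norml -(ler_pXn2r (n := 2)) ?nnegrE// expr1n.
  rewrite real_normK ?num_real//.
  apply: (@le_trans _ _ (enorm (w i) ^+ 2)).
    rewrite sqr_enorm (bigD1 k)//= lerDl sumr_ge0// => l _; exact: sqr_ge0.
  have := Dle _ (uD i); rewrite /= wn => ?.
  have : r ^+ 2 <= 1 by rewrite expr_le1.
  by move=> ?; lra.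
have S1 : exists2 r, S r & r <= 1.
  have [u ue un] := sphere_half.
  have h : Num.sqrt 2^-1 <= 1 :> R.
    by rewrite -[leRHS]sqrtr1 ler_wsqrtr// invf_le1// ler1n.
  exists (Num.sqrt 2^-1) => //; apply: AS => //; split=> //.
  by exists n, u; split=> // i; rewrite un sqr_sqrtr ?invr_ge0// subrr.
have lbA : lbound (radii D) 0 by move=> r [].
have lbS : lbound S 0 by move=> r /SA /lbA.
have hS : has_inf S by case: S1 => r Sr _; split; [exists r|exists 0].
have hA : has_inf (radii D).
  by case: S1 => r /SA Ar _; split; [exists r|exists 0].
have -> : inf (radii D) = inf S.
  apply/eqP; rewrite eq_le; apply/andP; split.
    apply: lb_le_inf => [|s /SA As]; first by case: hS.
    by apply: ge_inf => //; case: hA.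
  apply: lb_le_inf => [|s As]; first by case: hA.
  case: (leP s 1) => [s1|s1]; first by apply: ge_inf; [case: hS|exact: AS].
  case: S1 => r Sr r1; apply: le_trans (ltW s1); apply: le_trans r1.
  by apply: ge_inf => //; case: hS.
apply: SA; apply: cS => B /nbhs_ballP[eps /= eps0 Beps].
have [r Sr rlt] := inf_adherent eps0 hS.
exists r; split=> //; apply: Beps; rewrite /ball/= distrC ger0_norm.
  by rewrite ltrBlDl.
by rewrite subr_ge0; apply: ge_inf => //; case: hS.
Qed.

Theorem sphere_radius_attained : sphere_radii R e (inf (sphere_radii R e)).
Proof.
have -> : sphere_radii R e = radii [set x | x = 0].
  apply/seteqP; split=> r [r0 [d [u [d0 ue h]]]]; split=> //;
    exists d, u; split=> // i; first by rewrite /= h subrr.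
  by have /= /eqP := h i; rewrite subr_eq0 eqrXn2 ?enorm_ge0// => /eqP.
by apply: radii_attained => [|//|x /= -> //]; exact: closed_eq.
Qed.

Theorem ball_radius_attained : ball_radii R e (inf (ball_radii R e)).
Proof.
have -> : ball_radii R e = radii [set x | x <= 0].
  apply/seteqP; split=> r [r0].
    move=> [d [u [c [d0 ue h]]]]; split=> //.
    exists d, (fun i => u i - c); split=> // [i j /ue <-|i].
      by congr enorm; rewrite opprB addrA subrK.
    by rewrite /= subr_le0 ler_pXn2r ?nnegrE ?enorm_ge0.
  move=> [d [u [d0 ue h]]]; split=> //.
  exists d, u, 0; split=> // i.
  by have := h i; rewrite /= subr_le0 ler_pXn2r ?nnegrE ?enorm_ge0// subr0.
by apply: radii_attained => [|/=|x //]; [exact: closed_le|].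
Qed.

End Attained.

(* Main.v *)
Require Import Defs.
From mathcomp Require Import all_boot all_order all_algebra.
From mathcomp Require Import all_classical all_reals all_analysis.
From mathcomp Require Import ring lra.

Set Implicit Arguments.
Unset Strict Implicit.
Unset Printing Implicit Defensive.

Import Order.TTheory GRing.Theory Num.Theory.

Local Open Scope classical_set_scope.
Local Open Scope ring_scope.

(** A unit-distance representation inside a ball of squared radius [t], centered
at the origin up to translation, can be turned into one on the sphere of squared radius [t], so
the two sets of admissible radii coincide ([ball_radii_eq]).

If [2^-1 <= t], the vertices of a regular simplex of edge length 1, which fits on
the sphere of squared radius [2^-1], can be translated along an axis orthogonal
to its span until they lie on the given sphere ([lifted_simplex]).

Let [t <= 2^-1]. Squared norms and squared distances average: if [u] and [w]
are unit-distance representations, so is the orthogonal sum of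
[Num.sqrt (1 - s) *: u] and [Num.sqrt s *: w] ([sqnorms_convex]). Keep the
vertices of [u] that are on the sphere, and replace all the others by points of
squared norm [1 - t] of a lifted simplex orthogonal to [u]. This is again a
unit-distance representation: a kept and a replaced vertex are at squared
distance [t + (1 - t) = 1] ([sqnorms_push_out]). Now deform [u] towards it. The
vertices on the sphere stay there, and the squared norms of the others move
towards [1 - t >= t]; stopping when the first of them reaches the sphere leaves
fewer vertices strictly inside the ball. Repeating this brings all of them to
the sphere ([sqnorms_ball_sphere]). *)

Section SquaredNorms.
Context (R : realType).

Lemma sqr_enorm_row_mx (m n : nat) (x : 'rV[R]_m) (y : 'rV[R]_n) :
  enorm (row_mx x y) ^+ 2 = enorm x ^+ 2 + enorm y ^+ 2.
Proof.
rewrite !sqr_enorm big_split_ord /=.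
by congr (_ + _); apply: eq_bigr => k _; rewrite (row_mxEl, row_mxEr).
Qed.

Lemma sqr_enormZ (n : nat) (c : R) (x : 'rV[R]_n) :
  enorm (c *: x) ^+ 2 = c ^+ 2 * enorm x ^+ 2.
Proof.
by rewrite !sqr_enorm mulr_sumr; apply: eq_bigr => k _; rewrite mxE exprMn.
Qed.

Lemma enorm0 (n : nat) : enorm (0 : 'rV[R]_n) = 0.
Proof. by rewrite /enorm big1 ?sqrtr0// => k _; rewrite mxE expr0n. Qed.

Lemma enormN (n : nat) (x : 'rV[R]_n) : enorm (- x) = enorm x.
Proof. by congr Num.sqrt; apply: eq_bigr => k _; rewrite mxE sqrrN. Qed.

Lemma sqr_enorm_delta (n : nat) (i : 'I_n) :
  enorm (delta_mx 0 i : 'rV[R]_n) ^+ 2 = 1.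
Proof.
by rewrite sqr_enorm_mul trmx_delta mul_delta_mx mxE !eqxx.
Qed.

Lemma sqr_enorm_deltaB (n : nat) (i j : 'I_n) : i != j ->
  enorm (delta_mx 0 i - delta_mx 0 j : 'rV[R]_n) ^+ 2 = 2.
Proof.
move=> ij; have ji : j != i by rewrite eq_sym.
rewrite sqr_enorm_mul linearB /= !trmx_delta mulmxBl !mulmxBr.
rewrite !mul_delta_mx !mul_delta_mx_0// !mxE !eqxx /=.
by ring.
Qed.

(** The vectors [Num.sqrt 2^-1 *: delta_mx 0 i] are at distance 1 from each
other; a common extra coordinate raises their squared norm [2^-1] to [c]. *)
Lemma lifted_simplex (V : finType) (c : R) : 2^-1 <= c ->
  exists (d : nat) (z : V -> 'rV[R]_d),
    (forall i, enorm (z i) ^+ 2 = c) /\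
    (forall i j, i != j -> enorm (z i - z j) ^+ 2 = 1).
Proof.
move=> hc; have half0 : 0 <= 2^-1 :> R by rewrite invr_ge0.
exists (1 + #|V|)%N, (fun i => row_mx (Num.sqrt (c - 2^-1) *: delta_mx 0 ord0)
  (Num.sqrt 2^-1 *: delta_mx 0 (enum_rank i))); split=> [i|i j ij].
  rewrite sqr_enorm_row_mx !sqr_enormZ !sqr_enorm_delta !sqr_sqrtr ?subr_ge0//.
  by rewrite !mulr1 subrK.
rewrite opp_row_mx add_row_mx subrr -scalerBr sqr_enorm_row_mx enorm0.
rewrite sqr_enormZ sqr_sqrtr// sqr_enorm_deltaB ?(inj_eq enum_rank_inj)//.
by rewrite expr0n add0r mulVf ?pnatr_eq0.
Qed.

End SquaredNorms.

Section BallToSphere.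
Context (R : realType) (V : finType) (e : rel V).

(** The diagonals of the Gram matrices of unit-distance representations: the
dimension and the vectors are hidden, since only norms matter below. *)
Definition sqnorms (a : V -> R) : Prop :=
  exists (d : nat) (u : V -> 'rV[R]_d),
    (forall i j, e i j -> enorm (u i - u j) ^+ 2 = 1) /\
    (forall i, enorm (u i) ^+ 2 = a i).

Lemma sqnorms_convex (a b : V -> R) (s : R) : 0 <= s <= 1 ->
  sqnorms a -> sqnorms b -> sqnorms (fun i => (1 - s) * a i + s * b i).
Proof.
case/andP=> s0 s1 [d [u [ue ua]]] [d' [w [we wb]]].
have s1' : 0 <= 1 - s by rewrite subr_ge0.
exists (d + d')%N, (fun i =>
  row_mx (Num.sqrt (1 - s) *: u i) (Num.sqrt s *: w i)); split=> [i j eij|i].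
  rewrite opp_row_mx add_row_mx -!scalerBr sqr_enorm_row_mx !sqr_enormZ.
  by rewrite ue// we// !sqr_sqrtr// !mulr1 subrK.
by rewrite sqr_enorm_row_mx !sqr_enormZ ua wb !sqr_sqrtr.
Qed.

Hypothesis e_irr : irreflexive e.

Lemma adjacent_neq i j : e i j -> i != j.
Proof. by apply: contraTneq => ->; rewrite e_irr. Qed.

Lemma sqnorms_const (c : R) : 2^-1 <= c -> sqnorms (fun=> c).
Proof.
move=> /(@lifted_simplex R V)[d [z [zn zd]]].
by exists d, z; split=> // i j /adjacent_neq; exact: zd.
Qed.

(** The two squared radii [t] and [1 - t] add up to 1, so points on the two
spheres in orthogonal subspaces are at distance 1. *)
Lemma sqnorms_push_out (a : V -> R) (t : R) : t <= 2^-1 ->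
  sqnorms a -> sqnorms (fun i => if a i == t then t else 1 - t).
Proof.
move=> ht [d [u [ue ua]]].
have ht' : 2^-1 <= 1 - t by lra.
have [d' [z [zn zd]]] := @lifted_simplex R V _ ht'.
exists (d + d')%N, (fun i =>
  if a i == t then row_mx (u i) 0 else row_mx 0 (z i)); split=> [i j eij|i].
  case: ifPn => [/eqP ai|ai]; case: ifPn => [/eqP aj|aj];
    rewrite opp_row_mx add_row_mx sqr_enorm_row_mx ?oppr0 ?addr0 ?add0r.
  - by rewrite ue// enorm0 expr0n addr0.
  - by rewrite enormN ua ai zn addrC subrK.
  - by rewrite enormN ua aj zn addrC subrK.
  - by rewrite enorm0 expr0n add0r zd// adjacent_neq.
case: ifPn => [/eqP ai|ai]; rewrite sqr_enorm_row_mx enorm0 expr0n /=.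
  by rewrite addr0 ua ai.
by rewrite add0r zn.
Qed.

Lemma sqnorms_ball_sphere (a : V -> R) (t : R) : t <= 2^-1 ->
  sqnorms a -> (forall i, a i <= t) -> sqnorms (fun=> t).
Proof.
move=> ht; have [k] := ubnP #|[pred i | a i < t]|.
elim: k a => // k IH a ak Fa a_le.
case: (pickP [pred i | a i < t]) => [i0 /= ai0|all_t]; last first.
  have -> // : (fun=> t) = a.
  apply/funext => i; apply/eqP; rewrite eq_le a_le andbT leNgt.
  by have /= -> := all_t i.
(* The norms of the inner vertices are moved by one nondecreasing map, so the
   outermost of them is the first to reach the sphere. *)
case: (@arg_maxP _ _ V i0 (fun i => a i < t) a ai0) => m am m_max.
pose s := (t - a m) / (1 - t - a m).
have den : 0 < 1 - t - a m by lra.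
have s0 : 0 <= s by rewrite divr_ge0 ?ltW// subr_gt0.
have s1 : s <= 1 by rewrite ler_pdivrMr// mul1r; lra.
have sm : (1 - s) * a m + s * (1 - t) = t.
  by rewrite /s; field; rewrite gt_eqF.
have s01 : 0 <= s <= 1 by rewrite s0 s1.
pose b i := (1 - s) * a i + s * (if a i == t then t else 1 - t).
have Fb : sqnorms b := sqnorms_convex s01 Fa (sqnorms_push_out ht Fa).
have b_t i : a i = t -> b i = t by move=> ai; rewrite /b ai eqxx; ring.
have b_m : b m = t by rewrite /b (lt_eqF am).
apply: IH Fb _ => [|i].
  rewrite ltnS in ak; apply: leq_trans ak; apply: proper_card.
  apply/properP; split.
    apply/fintype.subsetP => i; rewrite !inE => bi; rewrite lt_neqAle a_le andbT.
    by apply: contraTneq bi => /b_t ->; rewrite ltxx.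
  by exists m; rewrite !inE // b_m ltxx.
have [/b_t -> //|ait] := eqVneq (a i) t.
have ai : a i < t by rewrite lt_neqAle ait a_le.
rewrite /b (negPf ait) -[leRHS]sm lerD2r ler_wpM2l ?subr_ge0//.
exact: m_max.
Qed.

Lemma ball_radii_eq : (0 < #|V|)%N -> ball_radii R e = sphere_radii R e.
Proof.
move=> V_gt0; apply/seteqP; split=> r [r0].
  move=> [d [u [c [_ ue uc]]]]; split=> //.
  have : sqnorms (fun=> r ^+ 2).
    have [h|/ltW h] := leP 2^-1 (r ^+ 2); first exact: sqnorms_const.
    apply: (@sqnorms_ball_sphere (fun i => enorm (u i - c) ^+ 2)) => // [|i].
      exists d, (fun i => u i - c); split=> // i j /ue.
      by rewrite opprB addrA subrK => ->; rewrite expr1n.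
    by rewrite ler_pXn2r ?nnegrE ?enorm_ge0.
  move=> [d' [w [we wr]]].
  have {}we : unit_distance_rep e w.
    move=> i j /we h; apply/eqP.
    by rewrite -(eqrXn2 (n := 2)) ?enorm_ge0// h expr1n.
  (* The dimension of [w] may be 0; dimension [#|V|] is always enough. *)
  have [v ve vw] := unit_distance_rep_square we.
  exists #|V|, v; split=> // i; apply/eqP.
  by rewrite -(eqrXn2 (n := 2)) ?enorm_ge0// vw wr.
move=> [d [u [d0 ue ur]]]; split=> //; exists d, u, 0; split=> // i.
by rewrite subr0 ur.
Qed.

End BallToSphere.

Theorem theorem3p5 (R : realType) (V : finType) (e : rel V)
    (V_nonempty : (0 < #|V|)%N) (e_sym : symmetric e) (e_irr : irreflexive e) :
  ball_number R e = hypersphere_number R e.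
Proof. by rewrite /ball_number ball_radii_eq. Qed.
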